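(* Let $\mathbb{H}$ be a hyperfield, let $\mathbb{T}$ be the tropical hyperfield, and let $f:\mathbb{H}\to\mathbb{T}$ be a relatively algebraically closed (RAC) hyperfield homomorphism, with induced map $f_*:\mathbb{H}[X_1,\dots,X_n]\to\mathbb{T}[X_1,\dots,X_n]$ given by applying $f$ coefficient-wise. Then for all polynomials $p\in\mathbb{H}[X_1,\dots,X_n]$, $$V(f_*(p))=f(V(p)),$$ where $f(V(p))\subseteq\mathbb{T}^n$ denotes the image of $V(p)\subseteq\mathbb{H}^n$ under $f$ applied coordinate-wise.
   Context: A hyperoperation on a set $\mathbb{H}$ is a map $\boxplus:\mathbb{H}\times\mathbb{H}\to\{\text{nonempty subsets of }\mathbb{H}\}$; for subsets, $A\boxplus B=\bigcup_{a\in A,b\in B}(a\boxplus b)$, and finite hypersums are defined by iteration: $x_1\boxplus\cdots\boxplus x_k=\bigcup_{x'\in x_2\boxplus\cdots\boxplus x_k}x_1\boxplus x'$. A hyperfield is a tuple $(\mathbb{H},\odot,\boxplus,1,0)$ with $0\ne 1$ such that: $(\mathbb{H},\odot,1)$ is a commutative monoid in which every nonzero element is invertible; $\boxplus$ is a commutative and associative hyperoperation; $0\boxplus x=\{x\}$; for each $x$ there is a unique element $-x$ with $0\in x\boxplus(-x)$; $x\in y\boxplus z$ iff $z\in x\boxplus(-y)$; $0\odot x=0$; and $a\odot(x\boxplus y)=(a\odot x)\boxplus(a\odot y)$. The tropical hyperfield $\mathbb{T}$ has underlying set $\mathbb{R}\cup\{-\infty\}$, multiplication $x\odot y=x+y$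 (with $x\odot(-\infty)=-\infty$), and hyperaddition $x\boxplus y=\{\max(x,y)\}$ if $x\neq y$, $x\boxplus x=\{z: z\le x\}$ (including $-\infty$). Its additive neutral element is $-\infty$ and its multiplicative neutral element is the real number $0$. A hyperfield homomorphism $f:\mathbb{H}_1\to\mathbb{H}_2$ is a map with $f(x\boxplus_1 y)\subseteq f(x)\boxplus_2 f(y)$, $f(x\odot_1 y)=f(x)\odot_2 f(y)$, sending the additive neutral element to the additive neutral element and the multiplicative neutral element to the multiplicative neutral element. $\mathbb{H}[X_1,\dots,X_n]$ is the set of formal finite expressions $p=\boxplus_I c_I\odot\underline{X}^I$ with multi-indices $I\in\mathbb{Z}_{\ge 0}^n$ and arbitrary coefficients $c_I\in\mathbb{H}$. For $\underline a\in\mathbb{H}^n$, $p(\underline a)=\boxplus_I c_I\odot\underline a^I\subseteq\mathbb{H}$ (a hypersum), and $V(p)=\{\underline a\in\mathbb{H}^n: 0\in p(\underline a)\}$, where $0$ denotes the additive neutral element of $\mathbb{H}$; elements of $V(p)$ are called roots of $p$. The push-forward is $f_*(p)=\boxplus_I f(c_I)\odot\underline X^I$. A hyperfield homomorphism $f:\mathbb{H}_1\to\mathbb{H}_2$ is relatively algebraically closed (RAC) if for all univariate polynomials $p\in\mathbb{H}_1[X]$ and every root $b\in V(f_*(p))$ there exists $a\in f^{-1}(b)$ such that $a\in V(p)$. *)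

(* Defs.v *)
From HB Require Import structures.
From mathcomp Require Import all_boot all_order all_algebra finmap.
From mathcomp Require Import boolp classical_sets reals.

Set Implicit Arguments.
Unset Strict Implicit.
Unset Printing Implicit Defensive.

Import Order.TTheory GRing.Theory Num.Theory.
Local Open Scope classical_set_scope.
Local Open Scope fmap_scope.

Definition hyperadd_set (T : Type) (add : T -> T -> set T) (A B : set T) : set T :=
  \bigcup_(a in A) \bigcup_(b in B) add a b.

HB.mixin Record isHyperfield (H : Type) := {
  hzero : H;
  hone : H;
  hopp : H -> H;
  hmul : H -> H -> H;
  hadd : H -> H -> set H;
  hzero_neq_hone : hzero <> hone;
  hmulA : associative hmul;
  hmulC : commutative hmul;
  hmul1 : left_id hone hmul;
  hmul_invertible : forall x, x <> hzero -> exists y, hmul x y = hone;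
  hadd_nonempty : forall x y, hadd x y !=set0;
  haddC : commutative hadd;
  haddA : forall x y z,
    hyperadd_set hadd [set x] (hadd y z) = hyperadd_set hadd (hadd x y) [set z];
  hadd0 : forall x, hadd hzero x = [set x];
  haddN : forall x, hadd x (hopp x) hzero;
  hopp_unique : forall x y, hadd x y hzero -> y = hopp x;
  hadd_reversible : forall x y z, hadd y z x <-> hadd x (hopp y) z;
  hmul0 : forall x, hmul hzero x = hzero;
  hmul_hadd : forall a x y, hmul a @` hadd x y = hadd (hmul a x) (hmul a y)
}.

#[short(type="hyperfieldType")]
HB.structure Definition Hyperfield := {H of isHyperfield H}.

Arguments hzero {_}.
Arguments hone {_}.

HB.instance Definition _ (H : hyperfieldType) :=
  Monoid.isComLaw.Build H hone hmul hmulA hmulC hmul1.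

Record hyperfield_hom (H1 H2 : hyperfieldType) (f : H1 -> H2) : Prop := {
  hom_hadd : forall x y, f @` hadd x y `<=` hadd (f x) (f y);
  hom_hmul : forall x y, f (hmul x y) = hmul (f x) (f y);
  hom_hzero : f hzero = hzero;
  hom_hone : f hone = hone
}.

Section Polynomials.
Variable H : hyperfieldType.

Fixpoint hypersum (s : seq H) : set H :=
  match s with
  | [::] => [set hzero]
  | [:: x] => [set x]
  | x :: s' => \bigcup_(x' in hypersum s') hadd x x'
  end.

Definition hexp (x : H) (k : nat) : H := iter k (hmul x) hone.

(* A formal expression is a finite map from multi-indices to coefficients; an  *)
(* explicit zero coefficient is allowed, and the empty map is the zero         *)
(* polynomial.                                                                 *)
Definition hyperpoly (n : nat) := {fmap n.-tuple nat -> H}.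

Definition hmonomial n (a : n.-tuple H) (e : n.-tuple nat) : H :=
  \big[hmul/hone]_(i < n) hexp (tnth a i) (tnth e i).

(* The order of summation comes from the enumeration of the support; it is     *)
(* irrelevant as hadd is associative and commutative.                          *)
Definition heval n (p : hyperpoly n) (a : n.-tuple H) : set H :=
  hypersum [seq hmul (p e) (hmonomial a (val e)) | e <- enum {: domf p}].

Definition hroots n (p : hyperpoly n) : set (n.-tuple H) :=
  [set a | heval p a hzero].

End Polynomials.

Definition hpush (H1 H2 : hyperfieldType) (f : H1 -> H2) n (p : hyperpoly H1 n) :
  hyperpoly H2 n := [fmap e : domf p => f (p e)].

Definition rel_alg_closed (H1 H2 : hyperfieldType) (f : H1 -> H2) : Prop :=
  forall (p : hyperpoly H1 1) (b : H2), hroots (hpush f p) [tuple b] ->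
    exists2 a : H1, f a = b & hroots p [tuple a].

Section Tropical.
Variable R : realType.

(* None stands for -oo. *)
Definition tropical : Type := option R.

Definition trop_le (x y : tropical) : bool :=
  match x, y with
  | None, _ => true
  | Some _, None => false
  | Some a, Some b => (a <= b)%R
  end.

Definition trop_max (x y : tropical) : tropical := if trop_le x y then y else x.

Definition trop_mul (x y : tropical) : tropical :=
  match x, y with
  | Some a, Some b => Some (a + b)%R
  | _, _ => None
  end.

Definition trop_add (x y : tropical) : set tropical :=
  if x == y :> option R then [set z | trop_le z x] else [set trop_max x y].

(* The additive inverse is the identity: -oo lies in x + y only if x = y. *)
Definition trop_opp (x : tropical) : tropical := x.

Lemma trop_le_refl x : trop_le x x.
Proof. by case: x => /=. Qed.

Lemma trop_le_trans y x z : trop_le x y -> trop_le y z -> trop_le x z.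
Proof. case: x y z => [x|] [y|] [z|] //=; exact: le_trans. Qed.

Lemma trop_le_anti x y : trop_le x y -> trop_le y x -> x = y.
Proof.
by case: x y => [x|] [y|] //= xy yx; congr Some; apply/le_anti; rewrite xy yx.
Qed.

Lemma trop_le_total x y : trop_le x y || trop_le y x.
Proof. case: x y => [x|] [y|] //=; exact: le_total. Qed.

(* z lies in x + y iff the maximum of x, y, z is attained at least twice. *)
Lemma trop_addP x y z : trop_add x y z <->
  [\/ x = y /\ trop_le z x, x = z /\ trop_le y x | y = z /\ trop_le x y].
Proof.
rewrite /trop_add; case: eqP => [->|xy] /=.
  split=> [zy|]; first by apply: Or31.
  by case=> [[_ //]|[-> _]|[-> _]]; rewrite trop_le_refl.
rewrite /trop_max; split.
  move=> ->; case: ifP => [le|nle]; first exact: Or33.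
  by apply: Or32; split=> //; move: (trop_le_total x y); rewrite nle.
case=> [[//]|[<- le]|[<- le]]; last by rewrite le.
by case: ifP => // le'; case: xy; apply: trop_le_anti.
Qed.

Lemma trop_addC : commutative trop_add.
Proof.
move=> x y; apply/seteqP; split=> z /trop_addP H; apply/trop_addP;
  by case: H => [[-> le]|[-> le]|[-> le]]; [apply: Or31|apply: Or33|apply: Or32].
Qed.

Lemma trop_addA_sub x y z v w : trop_add y z v -> trop_add x v w ->
  exists2 u, trop_add x y u & trop_add u z w.
Proof.
have le1 := trop_le_refl; have leT := trop_le_trans.
have add_l a b : trop_le b a -> trop_add a b a by move=> ?; apply/trop_addP/Or32.
have add_r a b : trop_le b a -> trop_add b a a by move=> ?; apply/trop_addP/Or33.
have add_d a b : trop_le b a -> trop_add a a b by move=> ?; apply/trop_addP/Or31.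
move=> /trop_addP[[<- vy]|[<- zy]|[<- yz]] /trop_addP.
- case=> [[xv wx]|[<- vx]|[<- xv]].
  + by subst v; exists y; [exact: add_r|apply: add_d; exact: leT vy].
  + case/orP: (trop_le_total x y) => le; first by exists y; [exact: add_r|exact: add_d].
    by exists x; exact: add_l.
  + by exists y; [apply: add_r; exact: leT vy|exact: add_d].
- case=> [[-> wx]|[<- yx]|[<- xy]].
  + case/orP: (trop_le_total z w) => le; first by exists w; [exact: add_d|exact: add_l].
    by exists z; exact: add_d.
  + by exists x; [exact: add_l|apply: add_l; exact: leT yx].
  + by exists y; [exact: add_r|exact: add_l].
- case=> [[-> wx]|[<- zx]|[<- xz]].
  + by exists z; [exact: add_l|exact: add_d].
  + by exists x; [apply: add_l; exact: leT zx|exact: add_l].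
  + case/orP: (trop_le_total x y) => le; first by exists y; exact: add_r.
    by exists x; [exact: add_l|exact: add_r].
Qed.

Lemma trop_addA x y z : hyperadd_set trop_add [set x] (trop_add y z) =
  hyperadd_set trop_add (trop_add x y) [set z].
Proof.
apply/seteqP; split=> w.
  move=> [_ -> [v yzv xvw]]; have [u xyu uzw] := trop_addA_sub yzv xvw.
  by exists u => //; exists z.
move=> [u + [_ ->]]; rewrite trop_addC [trop_add u z]trop_addC => yxu zuw.
have [v zyv vxw] := trop_addA_sub yxu zuw.
by exists x => //; exists v; rewrite trop_addC.
Qed.

Lemma trop_mulA : associative trop_mul.
Proof. by case=> [x|] [y|] [z|] //=; rewrite addrA. Qed.

Lemma trop_mulC : commutative trop_mul.
Proof. by case=> [x|] [y|] //=; rewrite addrC. Qed.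

Lemma trop_mul1 : left_id (Some 0%R) trop_mul.
Proof. by case=> [x|] //=; rewrite add0r. Qed.

Lemma trop_mul_invertible x : x <> None -> exists y, trop_mul x y = Some 0%R.
Proof. by case: x => [x|] // _; exists (Some (- x)%R); rewrite /= subrr. Qed.

Lemma trop_add_nonempty x y : trop_add x y !=set0.
Proof.
case/orP: (trop_le_total x y) => le; [exists y|exists x]; apply/trop_addP.
  exact: Or33.
exact: Or32.
Qed.

Lemma trop_add0 x : trop_add None x = [set x].
Proof.
apply/seteqP; split=> [z /trop_addP[[<-]|[<-]|[->]]|z ->] //=.
- by case: z.
- by case: x.
- by apply/trop_addP/Or33.
Qed.

Lemma trop_addN x : trop_add x (trop_opp x) None.
Proof. by apply/trop_addP/Or31. Qed.

Lemma trop_opp_unique x y : trop_add x y None -> y = trop_opp x.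
Proof. by case/trop_addP=> [[->]|[->]|[->]] //; [case: y|case: x]. Qed.

Lemma trop_add_reversible x y z :
  trop_add y z x <-> trop_add x (trop_opp y) z.
Proof.
rewrite /trop_opp; split=> /trop_addP[[e le]|[e le]|[e le]];
  subst; apply/trop_addP; by [apply: Or31|apply: Or32|apply: Or33].
Qed.

Lemma trop_mul0 x : trop_mul None x = None.
Proof. by []. Qed.

Lemma trop_mul_le a x y : trop_le x y -> trop_le (trop_mul a x) (trop_mul a y).
Proof. by case: a x y => [a|] [x|] [y|] //=; rewrite lerD2l. Qed.

Lemma trop_mul_add_sub a x y z :
  trop_add x y z -> trop_add (trop_mul a x) (trop_mul a y) (trop_mul a z).
Proof.
by case/trop_addP=> [[->]|[->]|[->]] /(@trop_mul_le a) le; apply/trop_addP;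
  [apply: Or31|apply: Or32|apply: Or33].
Qed.

Lemma trop_mul_add a x y :
  trop_mul a @` trop_add x y = trop_add (trop_mul a x) (trop_mul a y).
Proof.
apply/seteqP; split=> [_ [z xyz <-]|]; first exact: trop_mul_add_sub.
case: a => [a|] z; last first.
  rewrite trop_add0 => ->; have [t xyt] := trop_add_nonempty x y.
  by exists t.
have mulK t : trop_mul (Some (- a)%R) (trop_mul (Some a) t) = t.
  by case: t => [t|] //=; rewrite addKr.
have mulVK t : trop_mul (Some a) (trop_mul (Some (- a)%R) t) = t.
  by case: t => [t|] //=; rewrite addNKr.
move=> /(@trop_mul_add_sub (Some (- a)%R)); rewrite !mulK => h.
by exists (trop_mul (Some (- a)%R) z).
Qed.

Fact trop_zero_neq_one : (None : tropical) <> Some 0%R.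
Proof. by []. Qed.

HB.instance Definition _ := isHyperfield.Build tropical
  trop_zero_neq_one trop_mulA trop_mulC trop_mul1 trop_mul_invertible
  trop_add_nonempty trop_addC trop_addA trop_add0 trop_addN trop_opp_unique
  trop_add_reversible trop_mul0 trop_mul_add.

End Tropical.

(* Main.v *)
Require Import Defs.
From HB Require Import structures.
From mathcomp Require Import all_boot all_order all_algebra finmap.
From mathcomp Require Import boolp classical_sets reals.

(** Applied to the zero polynomial, relative algebraic closedness says that [f]
    is surjective. Given a root [b] of [f_* p], choose [c] with [f c_i = b_i]
    and substitute [X_i := c_i X^(w_i)], where the weights [w_i] are powers of
    a base exceeding every exponent of [p]. Distinct monomials of [p] then
    have distinct images, so the result is a univariate polynomial [q] whose
    coefficients are honest elements of [H], and [f_* q] takes at 1 the value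
    [f_* p] takes at [b]. A root [x] of [q] over 1 gives the root
    [(c_i x^(w_i))_i] of [p] over [b]. The target need not be tropical. *)

Set Implicit Arguments.
Unset Strict Implicit.
Unset Printing Implicit Defensive.

Local Open Scope classical_set_scope.

(** Uniqueness of base-[B] digits, by induction on the number of digits: reduction modulo [B]
    isolates the lowest one, and cancelling it and dividing by [B] leaves the tails. *)
Lemma sum_expn_inj (B n : nat) (e e' : 'I_n -> nat) :
  (forall i, e i < B) -> (forall i, e' i < B) ->
  \sum_(i < n) B ^ i * e i = \sum_(i < n) B ^ i * e' i -> e =1 e'.
Proof.
elim: n e e' => [|n IHn] e e' eB e'B; first by move=> _ [].
rewrite !big_ord_recl !expn0 !mul1n.
have shift (u : 'I_n.+1 -> nat) :
    \sum_(i < n) B ^ lift ord0 i * u (lift ord0 i) =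
    B * \sum_(i < n) B ^ i * u (lift ord0 i).
  by rewrite big_distrr /=; apply: eq_bigr => i _; rewrite mulnA -expnS.
rewrite !shift => eq_sum.
have B_gt0 : 0 < B := leq_ltn_trans (leq0n _) (eB ord0).
have eq0 : e ord0 = e' ord0.
  have := congr1 (modn^~ B) eq_sum.
  by rewrite ![_ + B * _]addnC ![B * _]mulnC !modnMDl !modn_small.
move: eq_sum; rewrite eq0 => /addnI/eqP; rewrite eqn_pmul2l // => /eqP eq_tail i.
by case: (unliftP ord0 i) => [j|] -> //; apply: (IHn _ _ _ _ eq_tail j).
Qed.

Section Hypersums.
Variable H : hyperfieldType.
Implicit Types (A B C : set H) (x y : H).

Lemma hyperadd_setA : associative (hyperadd_set (@hadd H)).
Proof.
move=> A B C; apply/seteqP; split=> z.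
- move=> [a Aa [v [b Bb [c Cc bcv]] av]].
  have : hyperadd_set hadd [set a] (hadd b c) z by exists a => //; exists v.
  rewrite haddA => -[u abu [_ -> uz]].
  by exists u; [exists a => //; exists b|exists c].
- move=> [u [a Aa [b Bb abu]] [c Cc uz]].
  have : hyperadd_set hadd (hadd a b) [set c] z by exists u => //; exists c.
  rewrite -haddA => -[_ -> [v bcv av]].
  by exists a => //; exists v => //; exists b => //; exists c.
Qed.

Lemma hyperadd_setC : commutative (hyperadd_set (@hadd H)).
Proof.
by move=> A B; apply/seteqP; split=> z [a Aa [b Bb abz]];
  exists b => //; exists a => //; rewrite haddC.
Qed.

Lemma hyperadd_set0 : left_id [set hzero] (hyperadd_set (@hadd H)).
Proof.
move=> A; apply/seteqP; split=> z.
  by move=> [_ -> [b Ab]]; rewrite hadd0 => ->.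
by move=> Az; exists hzero => //; exists z => //; rewrite hadd0.
Qed.

HB.instance Definition _ := Monoid.isComLaw.Build (set H) [set hzero]
  (hyperadd_set (@hadd H)) hyperadd_setA hyperadd_setC hyperadd_set0.

(** Subsets of [H] form a commutative monoid under hyperaddition, so hypersums can be reindexed and
    compared term by term as iterated products in it. The separate one-entry case of [hypersum]
    agrees because x + 0 = {x}. *)
Lemma hypersum_big (s : seq H) :
  hypersum s = \big[hyperadd_set (@hadd H)/[set hzero]]_(x <- s) [set x].
Proof.
elim: s => [|x s IHs]; first by rewrite big_nil.
rewrite big_cons -IHs /hyperadd_set bigcup_set1; case: s {IHs} => [|//].
by rewrite bigcup_set1 haddC hadd0.
Qed.

End Hypersums.

Section Monomials.
Variable H : hyperfieldType.
Implicit Types (x y : H) (k m : nat).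

Lemma hexpD x k m : hexp x (k + m) = hmul (hexp x k) (hexp x m).
Proof. by elim: k => [|k IHk] /=; [rewrite hmul1 | rewrite IHk hmulA]. Qed.

Lemma hexpM x k m : hexp x (k * m) = hexp (hexp x k) m.
Proof. by elim: m => [|m IHm]; [rewrite muln0 | rewrite mulnS hexpD IHm]. Qed.

Lemma hexpMl x y k : hexp (hmul x y) k = hmul (hexp x k) (hexp y k).
Proof.
by elim: k => [|k IHk] /=; [rewrite hmul1 | rewrite IHk Monoid.mulmACA].
Qed.

Lemma hexp1 k : hexp hone k = hone :> H.
Proof. by elim: k => //= k ->; rewrite hmul1. Qed.

Lemma hmonomial_twist n (c : n.-tuple H) (w : 'I_n -> nat) x (e : n.-tuple nat) :
  hmonomial [tuple hmul (tnth c i) (hexp x (w i)) | i < n] e =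
  hmul (hmonomial c e) (hmonomial [tuple x] [tuple \sum_(i < n) w i * tnth e i]).
Proof.
rewrite {3}/hmonomial big_ord1 /= !(tnth_nth x, tnth_nth 0) /=.
rewrite (big_morph (hexp x) (hexpD x) (erefl _)) -big_split /=.
by apply: eq_bigr => i _; rewrite tnth_mktuple hexpMl hexpM.
Qed.

End Monomials.

Section Coefficients.
Variable H : hyperfieldType.

(** Extending coefficients by zero lets sums run over plain multi-indices rather than over the
    subtype of the support. *)
Definition hcoef n (p : hyperpoly H n) (e : n.-tuple nat) : H :=
  odflt hzero (fnd p e).

Lemma heval_big n (p : hyperpoly H n) (a : n.-tuple H) :
  heval p a = \big[hyperadd_set (@hadd H)/[set hzero]]_(e <- domf p)
    [set hmul (hcoef p e) (hmonomial a e)].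
Proof.
rewrite /heval hypersum_big big_map big_enum big_seq_fsetE /=.
by apply: eq_bigr => e _; rewrite /hcoef -Some_fnd.
Qed.

End Coefficients.

Section Pushforward.
Variables (H1 H2 : hyperfieldType) (f : H1 -> H2).
Hypothesis f_hom : hyperfield_hom f.

Lemma hcoef_hpush n (p : hyperpoly H1 n) e : hcoef (hpush f p) e = f (hcoef p e).
Proof.
rewrite /hcoef; case: (boolP (e \in domf p)) => ep.
  by rewrite !(in_fnd (ep : e \in domf (hpush f p))) (in_fnd ep) /= ffunE.
by rewrite !not_fnd //= (hom_hzero f_hom).
Qed.

Lemma hom_hexp x k : f (hexp x k) = hexp (f x) k.
Proof.
by elim: k => [|k IHk] /=; [exact: hom_hone | rewrite (hom_hmul f_hom) IHk].
Qed.

Lemma hom_hmonomial n (a : n.-tuple H1) e :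
  f (hmonomial a e) = hmonomial (map_tuple f a) e.
Proof.
rewrite /hmonomial (big_morph f (hom_hmul f_hom) (hom_hone f_hom)).
by apply: eq_bigr => i _; rewrite tnth_map hom_hexp.
Qed.

Lemma hom_heval n (p : hyperpoly H1 n) (a : n.-tuple H1) x :
  heval p a x -> heval (hpush f p) (map_tuple f a) (f x).
Proof.
(* Push-forward keeps the support, so both hypersums run over the same list. The value [x] is
   generalized because it changes with each partial sum. *)
rewrite !heval_big /=; move: x.
elim/big_rec2: _ => [_ ->|e A B _ IH x]; first exact: hom_hzero.
move=> [_ -> [y By yx]]; exists (f (hmul (hcoef p e) (hmonomial a e))).
  by rewrite hcoef_hpush -hom_hmonomial -(hom_hmul f_hom).
by exists (f y); [exact: IH|apply: (hom_hadd f_hom); exists x].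
Qed.

End Pushforward.

Section Twist.
Variable n : nat.
Implicit Type w : 'I_n -> nat.

Definition wdeg w (e : n.-tuple nat) : 1.-tuple nat :=
  [tuple \sum_(i < n) w i * tnth e i].

Lemma wdeg_inj_in (E : {fset n.-tuple nat}) : exists w, {in E &, injective (wdeg w)}.
Proof.
pose B := (\max_(e <- E) \max_(i < n) tnth e i).+1.
have EB e i : e \in E -> tnth e i < B.
  move=> Ee; rewrite ltnS; apply: leq_trans (leq_bigmax_seq _ Ee isT).
  exact: leq_bigmax_cond.
exists (fun i => B ^ i) => e e' Ee Ee' /(congr1 (fun t => tnth t ord0)).
rewrite !(tnth_nth 0) /= => eq_sum; apply: eq_from_tnth.
by apply: sum_expn_inj eq_sum => i; apply: EB.
Qed.

(** [p (c_1 X^(w_1), ..., c_n X^(w_n))]; meaningful only when [wdeg w] is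
    injective on the support of [p], as otherwise the coefficients would be
    hypersums. *)
Definition twist (H : hyperfieldType) (p : hyperpoly H n) (c : n.-tuple H) w :
  hyperpoly H 1 :=
  [fmap d : (wdeg w @` domf p)%fset =>
    let e := xget [tuple 0 | i < n] [set e | e \in domf p /\ wdeg w e = val d] in
    hmul (hcoef p e) (hmonomial c e)].

Lemma hcoef_twist (H : hyperfieldType) (p : hyperpoly H n) (c : n.-tuple H) w e :
  {in domf p &, injective (wdeg w)} -> e \in domf p ->
  hcoef (twist p c w) (wdeg w e) = hmul (hcoef p e) (hmonomial c e).
Proof.
move=> w_inj ep; have wp : wdeg w e \in domf (twist p c w) by apply: in_imfset.
rewrite {1}/hcoef (in_fnd wp) /= ffunE /=.
(* The chosen preimage is [e] itself by injectivity; the default value never occurs, since [e] is a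
   preimage. *)
case: xgetP => [e' _ [e'p /w_inj -> //]|/(_ e)].
by case; split.
Qed.

(** Injectivity of [wdeg w] on the support matches the two hypersums term by term, giving an
    equality of sets, not just an inclusion. *)
Lemma heval_hpush_twist (H1 H2 : hyperfieldType) (f : H1 -> H2)
    (p : hyperpoly H1 n) (c : n.-tuple H1) w (y : H2) :
  hyperfield_hom f -> {in domf p &, injective (wdeg w)} ->
  heval (hpush f (twist p c w)) [tuple y] =
  heval (hpush f p) [tuple hmul (f (tnth c i)) (hexp y (w i)) | i < n].
Proof.
move=> f_hom w_inj; rewrite !heval_big /= big_imfset //=.
apply: eq_big_seq => e ep; rewrite !hcoef_hpush // hcoef_twist //.
rewrite (hom_hmul f_hom) (hom_hmonomial f_hom) -hmulA -hmonomial_twist.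
by congr [set hmul _ (hmonomial _ _)]; apply: eq_mktuple => i; rewrite tnth_map.
Qed.

Lemma hyperfield_hom_id (H : hyperfieldType) : hyperfield_hom (@id H).
Proof. by split=> // x y z [t xyt <-]. Qed.

Lemma hpush_id (H : hyperfieldType) m (p : hyperpoly H m) : hpush id p = p.
Proof.
apply/fmapP => e; case: (boolP (e \in domf p)) => ep.
  by rewrite (in_fnd (ep : e \in domf (hpush id p))) (in_fnd ep) ffunE.
by rewrite !not_fnd.
Qed.

Lemma heval_twist (H : hyperfieldType) (p : hyperpoly H n) (c : n.-tuple H) w x :
  {in domf p &, injective (wdeg w)} ->
  heval (twist p c w) [tuple x] =
  heval p [tuple hmul (tnth c i) (hexp x (w i)) | i < n].
Proof.
move=> w_inj.
(* Specialize the push-forward version to the identity homomorphism. *)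
by have := heval_hpush_twist c x (hyperfield_hom_id H) w_inj; rewrite !hpush_id.
Qed.

End Twist.

Section RelativelyAlgebraicallyClosed.
Variables (H1 H2 : hyperfieldType) (f : H1 -> H2).
Hypotheses (f_hom : hyperfield_hom f) (f_rac : rel_alg_closed f).

(** Every [y] is a root of the zero polynomial, the empty hypersum being {0}. *)
Lemma rac_surj y : exists x, f x = y.
Proof.
have [|x fx _] := f_rac (p := [fmap]%fmap) (b := y); last by exists x.
by rewrite /hroots /= heval_big big_seq_fset0.
Qed.

Theorem hroots_hpush n (p : hyperpoly H1 n) :
  hroots (hpush f p) = map_tuple f @` hroots p.
Proof.
apply/seteqP; split=> [b|_ [a pa <-]]; last first.
  by rewrite /hroots /= -(hom_hzero f_hom); apply: hom_heval.
have [g gK] := choice rac_surj; move=> pb.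
have [w w_inj] := wdeg_inj_in (domf p).
pose c := map_tuple g b.
have [|x fx px] := f_rac (p := twist p c w) (b := hone).
  (* At 1 every factor 1^(w_i) is 1, so the substituted point is [b]. *)
  rewrite /hroots /= heval_hpush_twist //; congr heval: pb.
  by apply: eq_from_tnth => i; rewrite tnth_mktuple tnth_map gK hexp1 hmulC hmul1.
exists [tuple hmul (tnth c i) (hexp x (w i)) | i < n].
  by rewrite /hroots /= -heval_twist.
apply: eq_from_tnth => i; rewrite tnth_map tnth_mktuple (hom_hmul f_hom).
by rewrite hom_hexp // fx hexp1 hmulC hmul1 tnth_map gK.
Qed.

End RelativelyAlgebraicallyClosed.

Theorem theorem1p1 (R : realType) (H : hyperfieldType) (f : H -> tropical R)
    (f_hom : hyperfield_hom f) (f_rac : rel_alg_closed f)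
    (n : nat) (p : hyperpoly H n) :
  hroots (hpush f p) = map_tuple f @` hroots p.
Proof. exact: hroots_hpush. Qed.
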